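(* For every even integer $r\ge 4$, there are infinitely many connected $r$-regular graphs $G\not\cong K_{r,r}$ with $\gamma_p(G)>\frac{|V(G)|}{r+1}$. Specifically, for every even $r\ge 4$ and every integer $k\ge 0$, the graph $E_k$ (depending on $r$, defined in the context), which is a connected $r$-regular graph of order $2r+1+k(r+1)$, satisfies $$\gamma_p(E_k)=k+2=\frac{2r+2+k(r+1)}{r+1}.$$
   Context: Graphs are finite and simple. Power domination: let $S\subseteq V(G)$. (OR 1) Initially, each vertex $v\in S$ observes itself and all its neighbors. (OR 2) Recursively, whenever an observed vertex has exactly one unobserved neighbor $u$, the vertex $u$ becomes observed. $S$ is a power dominating set (PDS) of $G$ if all vertices of $G$ eventually become observed, and $\gamma_p(G)$ is the minimum cardinality of a PDS of $G$. The graphs $E_k$. Let $r\ge 4$ be even. To build $E_0$, take two disjoint copies of $K_r$ and one additional vertex $u$; add $\frac r2$ independent (pairwise disjoint) edges between the two copies, and join $u$ to the $r$ vertices of the two copies ($\frac r2$ in each copy) that are not incident with any of these independent edges. For $j\ge1$, $E_j$ is obtained from $E_{j-1}$ as follows. Choose a vertex $x$ of $E_{j-1}$ that is joined to $\frac r2$ vertices in each of two copies of $K_r$ (the vertex $u$ if $j=1$, or otherwise one of the vertices produced by earlier splittings; all choices give isomorphic graphs). Split $x$ into two vertices $u_1^j,u_2^j$ of degree $\frac r2$, with $u_1^j$ joined to the $\frac r2$ neighbors of $x$ in one of the two copies and $u_2^j$ joined to the $\frac r2$ neighbors of $x$ in the other copy. Then add a new copy of $K_r$, join $u_1^j$ to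 $\frac r2$ of its vertices and $u_2^j$ to the remaining $\frac r2$ of its vertices. *)

(* Defs.v *)
From mathcomp Require Import all_boot.
Set Implicit Arguments.
Unset Strict Implicit.
Unset Printing Implicit Defensive.

Record sgraph := SGraph {
  vert :> finType;
  edge : rel vert;
  edge_sym : symmetric edge;
  edge_irr : irreflexive edge }.

Definition nbh (G : sgraph) (x : G) : {set G} := [set y | edge x y].

Definition regular (r : nat) (G : sgraph) : Prop :=
  forall x : G, #|nbh x| = r.

Definition connected (G : sgraph) : Prop :=
  0 < #|G| /\ forall x y : G, connect (@edge G) x y.

Definition isomorphic (G H : sgraph) : Prop :=
  exists2 f : G -> H, bijective f & forall x y, edge (f x) (f y) = edge x y.

Section PowerDomination.
Variable G : sgraph.
Implicit Types (S O : {set G}) (u v : G).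

Definition obs_init S : {set G} := S :|: \bigcup_(v in S) nbh v.

(* The vertices [u] such that some observed [v] has [u] as its only unobserved
   neighbor are added simultaneously; the set finally observed does not depend
   on the order in which the rule is applied. *)
Definition obs_step O : {set G} :=
  O :|: [set u | [exists v in O, nbh v :\: O == [set u]]].

(* Observed sets increase and are stationary once two successive ones agree, so
   #|G| rounds suffice; see [pdsP]. *)
Definition pds S : bool := iter #|G| obs_step (obs_init S) == [set: G].

Lemma obs_step_sub O : O \subset obs_step O.
Proof. exact: subsetUl. Qed.

Lemma obs_iter_card S n :
  (n <= #|iter n obs_step (obs_init S)|) ||
  (iter n.+1 obs_step (obs_init S) == iter n obs_step (obs_init S)).
Proof.
elim: n => [//|n IHn]; set O := iter n obs_step (obs_init S) in IHn *.
have [/eqP fixO | neqO] := boolP (obs_step O == O).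
  by rewrite !iterS -/O !fixO eqxx orbT.
move: IHn; rewrite iterS -/O (negbTE neqO) orbF => leO.
apply/orP; left; apply: leq_ltn_trans leO _; apply: proper_card.
by rewrite properEneq eq_sym neqO obs_step_sub.
Qed.

Lemma pdsP S :
  reflect (exists n, iter n obs_step (obs_init S) = [set: G]) (pds S).
Proof.
apply: (iffP eqP) => [<-|[n iterT]]; first by exists #|G|.
have stepT m : iter (m + n) obs_step (obs_init S) = [set: G].
  elim: m => [//|m IHm]; apply/eqP.
  by rewrite addSn iterS IHm -subTset obs_step_sub.
have /orP[leG | /eqP fixG] := obs_iter_card S #|G|.
  by apply/eqP; rewrite eqEcard subsetT cardsT.
by rewrite -(stepT #|G|) [#|G| + n]addnC iterD (@iter_fix _ n obs_step _ fixG).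
Qed.

Lemma pdsT : pds [set: G].
Proof.
by apply/pdsP; exists 0; apply/eqP; rewrite /obs_init -subTset subsetUl.
Qed.

Definition gamma_p : nat := #|[arg min_(S < [set: G] | pds S) #|S|]|.

Lemma gamma_pP :
  (exists2 S, pds S & #|S| = gamma_p) /\ (forall S, pds S -> gamma_p <= #|S|).
Proof.
by rewrite /gamma_p; case: arg_minnP => [|S pdsS minS];
  [exact: pdsT | split; first exists S].
Qed.

End PowerDomination.

Section CompleteBipartite.
Variables m n : nat.

Definition Kmn_edge : rel ('I_m + 'I_n) := fun x y =>
  match x, y with
  | inl _, inr _ | inr _, inl _ => true
  | _, _ => false
  end.

Lemma Kmn_sym : symmetric Kmn_edge. Proof. by case=> ? [?|?]. Qed.
Lemma Kmn_irr : irreflexive Kmn_edge. Proof. by case. Qed.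

Definition Kmn : sgraph := SGraph Kmn_sym Kmn_irr.

End CompleteBipartite.

(* The construction of E_k has to remember the copies of K_r: [copy x = Some i]
   if [x] lies in the copy number [i], and [copy x = None] if [x] is in none. *)
Record cgraph := CGraph {
  cgr :> sgraph;
  copy : cgr -> option nat }.

Definition nbh_in (G : cgraph) (x : G) (a : nat) : {set G} :=
  [set y in nbh x | copy y == Some a].

Section E0.
Variable r : nat.

(* [Some (s, i)] is the vertex [i] of the copy [s], and [None] is u.  The
   vertices [i < r./2] of the two copies are matched, the others joined to u. *)
Definition E0_edge : rel (option (bool * 'I_r)) := fun x y =>
  match x, y with
  | Some (s, i), Some (t, j) => if s == t then i != j else (i == j) && (i < r./2)
  | Some (_, i), None | None, Some (_, i) => r./2 <= i
  | None, None => false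
  end.

Lemma E0_sym : symmetric E0_edge.
Proof.
move=> [[s i]|] [[t j]|] //=; rewrite [t == s]eq_sym [j == i]eq_sym.
by case: eqP => // _; case: eqP => // ->.
Qed.

Lemma E0_irr : irreflexive E0_edge.
Proof. by move=> [[s i]|] //=; rewrite !eqxx. Qed.

Definition E0 : cgraph :=
  @CGraph (SGraph E0_sym E0_irr)
    (fun x => if x is Some (s, _) then Some (nat_of_bool s) else None).

End E0.

Section Splitting.
Variables (r : nat) (G : cgraph) (x : G) (a b c : nat).

(* [inl (inl v)] is a vertex [v != x] of [G]; [inl (inr false)] and
   [inl (inr true)] are the two vertices u_1 and u_2 into which [x] is split,
   towards the copies [a] and [b] respectively; [inr i] is a vertex of the new
   copy of K_r, which is given the number [c], and is joined to u_1 if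
   [i < r./2] and to u_2 otherwise. *)
Definition split_vert : finType := ({v : G | v != x} + bool + 'I_r)%type.

Definition split_edge : rel split_vert := fun p q =>
  match p, q with
  | inl (inl v), inl (inl w) => edge (val v) (val w)
  | inl (inl v), inl (inr d) | inl (inr d), inl (inl v) =>
      val v \in nbh_in x (if d then b else a)
  | inl (inr d), inr i | inr i, inl (inr d) => d == (r./2 <= i)
  | inr i, inr j => i != j
  | _, _ => false
  end.

Lemma split_sym : symmetric split_edge.
Proof.
move=> [[v|d]|i] [[w|d']|j] //=; first exact: edge_sym.
by rewrite eq_sym.
Qed.

Lemma split_irr : irreflexive split_edge.
Proof. by move=> [[v|d]|i] //=; rewrite ?edge_irr ?eqxx. Qed.

Definition split : cgraph :=
  @CGraph (SGraph split_sym split_irr)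
    (fun p => match p with
              | inl (inl v) => copy (val v)
              | inl (inr _) => None
              | inr _ => Some c
              end).

End Splitting.

(* [is_E r k G]: [G] is the graph E_k resulting from some sequence of choices of
   the split vertex.  The copies in E_k are numbered from 0 to k + 1. *)
Inductive is_E (r : nat) : nat -> cgraph -> Prop :=
| is_E_0 : is_E r 0 (E0 r)
| is_E_S k (G : cgraph) (x : G) (a b : nat) :
    is_E r k G -> copy x = None -> a != b ->
    #|nbh_in x a| = r./2 -> #|nbh_in x b| = r./2 ->
    is_E r k.+1 (split r x a b k.+2).

(* Main.v *)
Require Import Defs.
From mathcomp Require Import all_boot all_order all_algebra.
From mathcomp Require Import zify.
Set Implicit Arguments.
Unset Strict Implicit.
Unset Printing Implicit Defensive.

(** E_k is a necklace: k + 2 copies of K_r in a row, consecutive ones separated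
    by a connector joined to half of each, and the two end copies joined
    directly by a matching between the halves left free.

    A nonempty vertex set is a fort if no vertex outside it has exactly one
    neighbor in it.  The propagation rule cannot enter a fort that is entirely
    unobserved, so a power dominating set meets the closed neighborhood of every fort
    ([pds_meets_fort]).  Since r / 2 >= 2, two kinds of forts occur here.  The
    half of a copy C joined to a connector w is a fort, whose closed
    neighborhood is C together with w ([half_fort]); the two matched halves form
    a fort, whose closed neighborhood is the union of the end copies
    ([crossing_fort]).  Hence a power dominating set S has a vertex in an end
    copy, say the first.  Grouping each further copy with the connector just
    before it splits all vertices into k + 2 disjoint sets, and each of them
    meets S ([pds_card_end]).  Conversely, one vertex from each copy observes
    all copies at once, and then every connector is the only unobserved neighbor
    of some vertex ([copy_pds]).

    As the vertex split at each stage is arbitrary, these facts are derived from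
    a description of necklaces, [necklace], that the initial graph satisfies and
    every splitting preserves ([E0_necklace], [split_necklace]). *)

Lemma card_gt1_other (T : finType) (A : {set T}) (u : T) :
  1 < #|A| -> exists2 u', u' \in A & u' != u.
Proof.
case/card_gt1P=> y [z [yA zA neq_yz]].
have [eq_yu|] := eqVneq y u; last by exists y.
by exists z => //; rewrite eq_sym -eq_yu.
Qed.

Lemma card_ord_lt r m : m <= r -> #|[set i : 'I_r | i < m]| = m.
Proof.
move=> le_mr; rewrite -sum1_card (eq_bigl (fun i : 'I_r => i < m)); last first.
  by move=> i; rewrite inE.
by rewrite -(big_ord_widen r (fun=> 1) le_mr) sum1_card card_ord.
Qed.

Lemma card_ord_ge r m : m <= r -> #|[set i : 'I_r | m <= i]| = r - m.
Proof.
move=> le_mr; have := cardsC [set i : 'I_r | i < m].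
rewrite card_ord_lt // card_ord => card_r.
rewrite (_ : [set i | _] = ~: [set i : 'I_r | i < m]).
  by rewrite -[in RHS]card_r addKn.
by apply/setP=> i; rewrite !inE -leqNgt.
Qed.

(** * Forts *)

Section Forts.
Variable G : sgraph.
Implicit Types (F S : {set G}).

(** Equivalently, no vertex outside [F] has exactly one neighbor in [F]. *)
Definition fort F :=
  forall y u, y \notin F -> u \in F -> edge y u ->
  exists2 u', u' \in F & (u' != u) && edge y u'.

(** If [S] misses the closed neighborhood of [F], then [F] is unobserved at the
    start, and it stays so: a vertex forcing [u] in [F] would lie outside [F]
    and have a second, also unobserved, neighbor in [F]. *)
Lemma pds_meets_fort S F u0 :
    pds S -> fort F -> u0 \in F ->
  exists2 v, v \in S & exists2 u, u \in F & (v == u) || edge v u.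
Proof.
move=> /pdsP[n iterT] fortF u0F.
have [/exists_inP[v vS /exists_inP[u uF vu]]|noS] :=
  boolP [exists v in S, [exists u in F, (v == u) || edge v u]].
  by exists v => //; exists u.
have farF v u : v \in S -> u \in F -> (v == u) || edge v u = false.
  move=> vS uF; apply: contraNF noS => vu.
  by apply/exists_inP; exists v => //; apply/exists_inP; exists u.
suff dark m u : u \in F -> u \notin iter m (@obs_step G) (obs_init S).
  by have := dark n u0 u0F; rewrite iterT inE.
elim: m u => [|m IHm] u uF /=.
  rewrite inE; apply/orP=> -[uS|/bigcupP[v vS]].
    by have := farF u u uS uF; rewrite eqxx.
  by rewrite inE => vu; have := farF v u vS uF; rewrite vu orbT.
set O := iter m _ _ in IHm *.
rewrite !inE (negbTE (IHm _ uF)) /=; apply/exists_inP => -[v vO /eqP nbh_v].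
have vF : v \notin F by apply: contraL vO => /IHm.
have vu : edge v u.
  by have := set11 u; rewrite -nbh_v !inE => /andP[].
have [u' u'F /andP[neq_u' vu']] := fortF v u vF uF vu.
have: u' \in nbh v :\: O by rewrite !inE vu' andbT; exact: IHm.
by rewrite nbh_v inE (negbTE neq_u').
Qed.

End Forts.

(** * Necklaces of cliques *)

(** The [n] copies are cliques.  A vertex [v] of a copy has a single neighbor
    [out v] outside it.  A connector (a vertex in no copy) has its neighbors in
    the copies [L w] and [R w], half in each.  The end copies [p] and [q] are
    the only ones that may lack a connector before, resp. after, them; edges
    between copies only join [p] and [q].

    The order of the copies along the row is encoded only through the fact that
    [L] and [R] cover them; the counting relies on this alone, and a splitting
    preserves it without any renumbering. *)
Record necklace (r n : nat) (G : cgraph) (out : G -> G) (L R : G -> nat)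
    (p q : nat) : Prop := Necklace {
  copy_lt : forall (v : G) c, copy v = Some c -> c < n;
  copy_card : forall c, c < n -> #|[set v : G | copy v == Some c]| = r;
  copy_clique : forall (v w : G) c,
    copy v = Some c -> copy w = Some c -> edge v w = (v != w);
  out_copy : forall (v : G) c, copy v = Some c -> copy (out v) != Some c;
  out_edge : forall (v w : G) c,
    copy v = Some c -> copy w != Some c -> edge v w = (w == out v);
  link_sides : forall w : G, copy w = None -> L w != R w;
  link_left : forall w : G, copy w = None -> #|nbh_in w (L w)| = r./2;
  link_right : forall w : G, copy w = None -> #|nbh_in w (R w)| = r./2;
  link_nbh : forall w v : G, copy w = None -> edge w v ->
    copy v = Some (L w) \/ copy v = Some (R w);
  left_cover : forall c, c < n -> c != q ->
    exists2 w : G, copy w = None & L w = c;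
  right_cover : forall c, c < n -> c != p ->
    exists2 w : G, copy w = None & R w = c;
  cross_ends : forall (v : G) c d, copy v = Some c -> copy (out v) = Some d ->
    (c = p /\ d = q) \/ (c = q /\ d = p);
  cross_card : forall c, c = p \/ c = q ->
    1 < #|[set v : G | (copy v == Some c) && (copy (out v) != None)]| }.

(** Reading the row backwards; this makes the two ends, and the two orders in
    which a splitting can name its copies, interchangeable. *)
Lemma necklace_sym r n G out L R p q :
  @necklace r n G out L R p q -> necklace r n out R L q p.
Proof.
case=> *; split=> //; auto.
- by move=> w w0; rewrite eq_sym; auto.
- by move=> w v w0 wv; apply/or_comm; auto.
- by move=> v c d vc vd; apply/or_comm; eauto.
- by move=> c /or_comm; auto.
Qed.

Section NecklaceTheory.
Variables (r n : nat) (G : cgraph) (out : G -> G) (L R : G -> nat) (p q : nat).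
Hypothesis r_ge4 : 4 <= r.
Hypothesis neckG : necklace r n out L R p q.

Lemma out_unique (v w : G) c :
  copy v = Some c -> copy w != Some c -> edge v w -> w = out v.
Proof. by move=> vc wc; rewrite (out_edge neckG vc wc) => /eqP. Qed.

Lemma edge_out (v : G) c : copy v = Some c -> edge v (out v).
Proof. by move=> vc; rewrite (out_edge neckG vc (out_copy neckG vc)). Qed.

(** A vertex adjacent to some vertex [u] of the half is in the same clique, or is
    [out u], that is [w]; both are adjacent to the whole half. *)
Lemma half_fort (w : G) c :
  copy w = None -> #|nbh_in w c| = r./2 -> fort (nbh_in w c).
Proof.
move=> w0 card_w y u yF; rewrite !inE => /andP[wu /eqP uc] yu.
have [|u' u'F neq_u'] := @card_gt1_other _ (nbh_in w c) u.
  by rewrite card_w; lia.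
exists u' => //; rewrite neq_u' /=.
have [yc|yc] := eqVneq (copy y) (Some c).
  have u'c : copy u' = Some c by move: u'F; rewrite !inE => /andP[_ /eqP].
  by rewrite (copy_clique neckG yc u'c); apply: contraNneq yF => ->.
have -> : y = w.
  rewrite edge_sym in yu; rewrite edge_sym in wu.
  by rewrite (out_unique uc yc yu) (out_unique uc _ wu) // w0.
by move: u'F; rewrite !inE => /andP[].
Qed.

Lemma half_meets (S : {set G}) (w : G) c :
    pds S -> copy w = None -> #|nbh_in w c| = r./2 ->
  exists2 v : G, v \in S & copy v = Some c \/ v = w.
Proof.
move=> pdsS w0 card_w.
have [u0 u0F] : exists u, u \in nbh_in w c by apply/card_gt0P; rewrite card_w; lia.
have [v vS [u]] := pds_meets_fort pdsS (half_fort w0 card_w) u0F.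
rewrite !inE => /andP[wu /eqP uc] vu; exists v => //.
have [vc|vc] := eqVneq (copy v) (Some c); [by left | right].
case/predU1P: vu => [eq_vu|vu]; first by rewrite eq_vu uc eqxx in vc.
rewrite edge_sym in vu; rewrite edge_sym in wu.
by rewrite (out_unique uc vc vu) (out_unique uc _ wu) // w0.
Qed.

(** The matched halves of the two end copies, seen as the vertices whose outside
    neighbor lies in a copy again. *)
Definition crossing := [set v : G | (copy v != None) && (copy (out v) != None)].

Lemma crossing_end v : v \in crossing -> copy v = Some p \/ copy v = Some q.
Proof.
rewrite !inE => /andP[].
case vc: (copy v) => [c|] // _; case ovd: (copy (out v)) => [d|] // _.
by case: (cross_ends neckG vc ovd) => -[-> _]; [left | right].
Qed.

Lemma crossing_out v : v \in crossing -> out v \in crossing.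
Proof.
rewrite !inE => /andP[].
case vc: (copy v) => [c|] // _; case ovd: (copy (out v)) => [d|] // _ /=.
rewrite -(@out_unique (out v) v d) ?vc //.
  by have := out_copy neckG vc; rewrite ovd eq_sym.
by rewrite edge_sym (edge_out vc).
Qed.

Lemma crossing_nbr y u :
  u \in crossing -> edge y u -> y \in crossing \/ copy y = copy u.
Proof.
move=> uF yu; have := uF; rewrite inE => /andP[].
case uc: (copy u) => [c|] // _ _.
have [yc|yc] := eqVneq (copy y) (Some c); [by right | left].
by rewrite edge_sym in yu; rewrite (out_unique uc yc yu) crossing_out.
Qed.

(** [out] preserves [crossing], so an outside vertex adjacent to a crossing
    vertex is in the same end copy, where there are at least two of them. *)
Lemma crossing_fort : fort crossing.
Proof.
move=> y u yF uF yu; case: (crossing_nbr uF yu) => [|eq_c]; first by rewrite (negbTE yF).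
have [c uc end_c] : exists2 c, copy u = Some c & c = p \/ c = q.
  by case: (crossing_end uF) => uc; eexists; eauto.
have [u' u'F neq_u'] := card_gt1_other u (cross_card neckG end_c).
move: u'F; rewrite inE => /andP[/eqP u'c u'o].
have u'F : u' \in crossing by rewrite inE u'c.
exists u' => //; rewrite neq_u' (copy_clique neckG (c := c)) ?eq_c //.
by apply: contraNneq yF => ->.
Qed.

Lemma ends_meet (S : {set G}) :
  pds S -> exists2 v : G, v \in S & copy v = Some p \/ copy v = Some q.
Proof.
move=> pdsS.
have /card_gt0P[u0] := ltnW (cross_card neckG (or_introl (erefl p))).
rewrite inE => /andP[/eqP u0p u0o].
have u0F : u0 \in crossing by rewrite inE u0p.
have [v vS [u uF vu]] := pds_meets_fort pdsS crossing_fort u0F.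
exists v => //; case/predU1P: vu => [->|vu]; first exact: crossing_end.
case: (crossing_nbr uF vu) => [|->]; exact: crossing_end.
Qed.

(** Sending a vertex of a copy to that copy and a connector [w] to [R w] maps [S]
    onto the set of copies: [v] takes care of [p], and any other copy [c] is
    [R w] for some [w], so that [S] meets [c] or contains [w]. *)
Lemma pds_card_end (S : {set G}) (v : G) :
  pds S -> v \in S -> copy v = Some p -> n <= #|S|.
Proof.
move=> pdsS vS vp.
pose g w := if copy w is Some c then c else R w.
have sub_g : {subset iota 0 n <= [seq g w | w <- enum S]}.
  move=> c; rewrite mem_iota /= add0n => ltc.
  suff [w wS <-] : exists2 w, w \in S & g w = c.
    by apply: map_f; rewrite mem_enum.
  have [->|c_p] := eqVneq c p; first by exists v; rewrite ?/g ?vp.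
  have [w w0 Rw] := right_cover neckG ltc c_p.
  have [|x xS xw] := @half_meets S w c pdsS w0.
    by rewrite -Rw (link_right neckG).
  by exists x => //; rewrite /g; case: xw => ->; rewrite ?w0.
by have := uniq_leq_size (iota_uniq 0 n) sub_g; rewrite size_iota size_map -cardE.
Qed.

(** One vertex per copy: all copies are observed initially, and all connectors
    after a single propagation round. *)
Lemma copy_pds : exists2 S : {set G}, pds S & #|S| <= n.
Proof.
have copy_mem c : c < n -> exists v : G, copy v == Some c.
  move=> ltc; have: 0 < #|[set v : G | copy v == Some c]|.
    by rewrite (copy_card neckG ltc); lia.
  by case/card_gt0P=> v; rewrite inE; exists v.
pose f (i : 'I_n) := xchoose (copy_mem i (ltn_ord i)).
have copy_f i : copy (f i) = Some (i : nat) by apply/eqP/(xchooseP (copy_mem i _)).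
exists [set f i | i : 'I_n]; last first.
  by rewrite (leq_trans (leq_imset_card _ _)) ?card_ord.
have seen v c : copy v = Some c -> v \in obs_init [set f i | i : 'I_n].
  move=> vc; have ltc := copy_lt neckG vc.
  rewrite inE; have [->|neq_v] := eqVneq v (f (Ordinal ltc)).
    by rewrite imset_f.
  apply/orP; right; apply/bigcupP; exists (f (Ordinal ltc)); rewrite ?imset_f //.
  by rewrite inE (copy_clique neckG (copy_f (Ordinal ltc)) vc) eq_sym.
apply/pdsP; exists 1 => /=; move: (obs_init _) seen => O seen.
apply/setP=> w; rewrite [RHS]inE inE; case w_seen: (w \in O) => //=.
case w0: (copy w) => [c|]; first by rewrite (seen _ _ w0) in w_seen.
have /card_gt0P[v] : 0 < #|nbh_in w (L w)| by rewrite (link_left neckG w0); lia.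
rewrite !inE => /andP[wv /eqP vc]; apply/exists_inP.
exists v; first exact: seen vc.
rewrite edge_sym in wv; apply/eqP/setP => x; rewrite !inE.
have [->|neq_xw] := eqVneq x w; first by rewrite w_seen wv.
apply/negP => /andP[x_dark vx].
have xc : copy x != Some (L w) by apply: contraNneq x_dark => /seen.
by rewrite (out_unique vc xc vx) (out_unique vc _ wv) ?w0 ?eqxx in neq_xw.
Qed.

Lemma necklace_regular : ~~ odd r -> regular r G.
Proof.
move=> r_even v; case vc: (copy v) => [c|].
  have -> : nbh v = out v |: ([set w | copy w == Some c] :\ v).
    apply/setP=> w; rewrite !inE; have [wc|wc] := eqVneq (copy w) (Some c).
      rewrite (copy_clique neckG vc wc) eq_sym andbT.
      suff /negbTE-> : w != out v by [].
      by apply: contraNneq (out_copy neckG vc) => <-; rewrite wc.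
    by rewrite (out_edge neckG vc wc) andbF orbF.
  rewrite cardsU1 !inE (negbTE (out_copy neckG vc)) andbF /=.
  have := cardsD1 v [set w | copy w == Some c].
  by rewrite (copy_card neckG (copy_lt neckG vc)) inE vc eqxx => ->.
have -> : nbh v = nbh_in v (L v) :|: nbh_in v (R v).
  apply/setP=> w; rewrite !inE; case vw: (edge v w) => //=.
  by case: (link_nbh neckG vc vw) => ->; rewrite eqxx ?orbT.
rewrite cardsU (link_left neckG vc) (link_right neckG vc).
suff -> : nbh_in v (L v) :&: nbh_in v (R v) = set0.
  by rewrite cards0 subn0; lia.
apply/setP=> w; rewrite !inE; apply/negP=> /andP[/andP[_ /eqP ->] /andP[_ /eqP[]]].
by apply/eqP; exact: link_sides neckG _ vc.
Qed.

End NecklaceTheory.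

Lemma necklace_gamma r n G out L R p q :
  4 <= r -> @necklace r n G out L R p q -> gamma_p G = n.
Proof.
move=> r_ge4 neckG; have [[S pdsS <-] minG] := gamma_pP G.
have [T pdsT leT] := copy_pds r_ge4 neckG.
apply/eqP; rewrite eqn_leq; apply/andP; split.
  exact: leq_trans (minG T pdsT) leT.
have [v vS [vp|vq]] := ends_meet neckG pdsS.
  exact: (pds_card_end r_ge4 neckG pdsS vS vp).
exact: (pds_card_end r_ge4 (necklace_sym neckG) pdsS vS vq).
Qed.

(** * The initial graph *)

Lemma E0_card r : #|E0 r| = 2 * r + 1.
Proof. by rewrite card_option card_prod card_bool card_ord addn1. Qed.

Lemma E0_necklace r : 4 <= r -> ~~ odd r ->
  exists out, @necklace r 2 (E0 r) out (fun=> 0) (fun=> 1) 0 1.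
Proof.
move=> r_ge4 r_even.
have halfK : r - r./2 = r./2 by lia.
pose out (x : E0 r) : E0 r :=
  if x is Some (s, i) then if i < r./2 then Some (~~ s, i) else None else None.
have inj_at (s : bool) : injective (fun i : 'I_r => Some (s, i)) by move=> i j [].
have half_at (s : bool) : #|nbh_in (None : E0 r) s| = r./2.
  rewrite -[RHS]halfK -(@card_ord_ge r) ?leq_half_double //; last by lia.
  rewrite -(card_imset _ (inj_at s)); apply: eq_card => -[[t i]|]; last first.
    by rewrite !inE; apply/esym/imsetP => -[].
  rewrite !inE /=; apply/andP/imsetP => [[le_i /eqP[eq_ts]]|[j]].
    by exists i; rewrite ?inE //; case: t s eq_ts => -[].
  by rewrite inE => le_j [-> ->].
exists out; split=> //=.
- by move=> [[[] i]|] // c [<-].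
- move=> c lt_c2; have -> : c = (c == 1) :> nat by case: c lt_c2 => [|[]].
  rewrite -[RHS]card_ord -(card_imset _ (inj_at (c == 1))).
  apply: eq_card => -[[t i]|]; rewrite !inE; last by apply/esym/imsetP => -[].
  apply/eqP/imsetP => [[eq_t]|[j _ [-> _ //]]].
  by exists i => //; case: t eq_t; case: eqP.
- move=> [[s i]|] // [[t j]|] // c [<-] [].
  case: s t => -[] // _; by congr (~~ _); apply/eqP/eqP => [->|[]].
- by move=> [[s i]|] // c [<-] /=; case: ifP => //; case: s.
- move=> [[s i]|] // [[t j]|] c [<-] /= neq_t; rewrite /out; last by case: ltnP.
  rewrite (_ : (s == t) = false); last by apply: contraNF neq_t => /eqP->.
  case: ltnP => _; last by rewrite andbF.
  rewrite andbT; apply/eqP/eqP => [->|[_ ->] //].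
  by case: s t neq_t => -[].
- by move=> [[s i]|] // _; exact: (half_at false).
- by move=> [[s i]|] // _; exact: (half_at true).
- by move=> [[s i]|] // [[[] j]|] // _ _; [right | left].
- by move=> [|[|]] // _ _; exists None.
- by move=> [|[|]] // _ _; exists None.
- move=> [[s i]|] // c d [<-]; rewrite /out; case: ifP => //= _ [<-].
  by case: s; [right | left].
move=> c ends_c; have [s ->] : exists s : bool, c = s.
  by case: ends_c => ->; [exists false | exists true].
apply: (@leq_trans r./2); first by lia.
rewrite -{1}(@card_ord_lt r r./2); last by lia.
rewrite -(card_imset _ (inj_at s)); apply/subset_leq_card/subsetP => x.
by case/imsetP=> i; rewrite !inE => lt_i ->; rewrite /= eqxx lt_i.
Qed.

Lemma E0_connected r : 4 <= r -> connected (E0 r).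
Proof.
move=> r_ge4; split; first by rewrite E0_card addn1.
have last_r : r.-1 < r by lia.
have to_u (x : E0 r) : connect (@edge (E0 r)) x None.
  case: x => [[s i]|]; last exact: connect0.
  apply: (@connect_trans _ _ (Some (s, Ordinal last_r))).
    have [->|neq_i] := eqVneq i (Ordinal last_r); first exact: connect0.
    by apply: connect1; rewrite /= eqxx.
  by apply: connect1 => /=; lia.
move=> x y; apply: connect_trans (to_u x) _.
by rewrite (sym_connect_sym (@edge_sym (E0 r))) to_u.
Qed.

(** * Splitting a connector *)

Section Split.
Variables (r n : nat) (G : cgraph) (x : G) (a b : nat).

Let H := Defs.split r x a b n.
Let old (v : {v : G | v != x}) : H := inl (inl v).
Let piece (d : bool) : H := inl (inr d).
Let new (i : 'I_r) : H := inr i.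

(** Transfers the cardinals of neighborhoods and copies from [G] to the split
    graph. *)
Lemma card_old (A : {set G}) (A' : {set H}) :
    x \notin A ->
    (forall y : H, (y \in A') = if y is inl (inl v) then val v \in A else false) ->
  #|A'| = #|A|.
Proof.
move=> xA defA'; pose base (y : H) : G := if y is inl (inl v) then val v else x.
rewrite -(card_in_imset (f := base) (D := A')); last first.
  by move=> [[v|d]|i] [[w|d']|j]; rewrite !defA' //= => _ _ /val_inj->.
apply: eq_card => v; apply/imsetP/idP => [[[[w|d]|i]]|vA]; rewrite ?defA' //.
  by move=> wA ->.
have neq_vx : v != x by apply: contraNneq xA => <-.
by exists (old (Sub v neq_vx)); rewrite ?defA' /= ?SubK.
Qed.

Lemma split_card : #|H| = #|G| + r.+1.
Proof.
rewrite card_sum card_sum card_bool card_ord card_sig.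
have := cardC1 x; rewrite -(prednK (_ : 0 < #|G|)); last by apply/card_gt0P; exists x.
by move=> -> /=; lia.
Qed.

(** Mapping [x] to one of its two pieces sends every edge of [G] to a pair of
    connected vertices, because the pieces are linked through the new copy. *)
Lemma split_connected :
    (forall v, edge x v -> copy v = Some a \/ copy v = Some b) -> 4 <= r ->
  connected G -> connected H.
Proof.
move=> nbh_x r_ge4 [_ connG].
split; first by rewrite split_card addnS.
have symH := sym_connect_sym (@edge_sym H).
have lt0r : 0 < r by lia.
have last_r : r.-1 < r by lia.
have new_piece d i : connect (@edge H) (new i) (piece d).
  pose j := if d then Ordinal last_r else Ordinal lt0r.
  apply: (@connect_trans _ _ (new j)).
    by have [->|neq_i] := eqVneq i j; [exact: connect0 | exact: connect1].
  by apply: connect1; rewrite /j; case: (d) => /=; lia.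
have pieces d d' : connect (@edge H) (piece d) (piece d').
  apply: connect_trans (new_piece d' (Ordinal lt0r)).
  by rewrite symH; exact: new_piece.
pose emb v : H := if insub v is Some z then old z else piece false.
have emb_old v : emb (val v) = old v by rewrite /emb valK.
have emb_x : emb x = piece false by rewrite /emb insubF //= eqxx.
have piece_nbh v : edge x v -> connect (@edge H) (piece false) (emb v).
  move=> xv; rewrite /emb; case: insubP => [z _ val_z|]; last by rewrite connect0.
  apply: (@connect_trans _ _ (piece (copy v != Some a))); first exact: pieces.
  apply: connect1; rewrite /= val_z !inE xv /=.
  have [->|neq_a] := eqVneq (copy v) (Some a); first by rewrite eqxx.
  by case: (nbh_x v xv) neq_a => ->; rewrite /= eqxx.
have emb_edge v w : edge v w -> connect (@edge H) (emb v) (emb w).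
  have [->|neq_vx] := eqVneq v x; first by rewrite emb_x; exact: piece_nbh.
  have [->|neq_wx] := eqVneq w x.
    by rewrite edge_sym emb_x symH; exact: piece_nbh.
  by rewrite /emb !insubT => vw; apply: connect1.
have emb_connect v w : connect (@edge H) (emb v) (emb w).
  case/connectP: (connG v w) => s path_s ->.
  elim: s v path_s => [|u s IHs] v /=; first by rewrite connect0.
  by case/andP=> /emb_edge vu /IHs; exact: connect_trans.
have to_piece (y : H) : connect (@edge H) y (piece false).
  case: y => [[v|d]|i]; [|exact: pieces|exact: new_piece].
  by rewrite -emb_x -[inl _]emb_old.
by move=> y z; apply: connect_trans (to_piece y) _; rewrite symH.
Qed.

(** The new copy is inserted between [L x = a] and [R x = b]: the first piece of
    [x] separates [a] from it, the second one separates it from [b], and the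
    ends do not change. *)
Lemma split_necklace out L R p q :
    4 <= r -> ~~ odd r -> copy x = None -> L x = a -> R x = b ->
    necklace r n out L R p q ->
  exists out' L' R', @necklace r n.+1 H out' L' R' p q.
Proof.
move=> r_ge4 r_even x0 Lx Rx neckG.
have side_lt c : #|nbh_in x c| = r./2 -> c < n.
  move=> card_x; have /card_gt0P[v] : 0 < #|nbh_in x c| by rewrite card_x; lia.
  by rewrite !inE => /andP[_ /eqP]; exact: (copy_lt neckG).
have card_a : #|nbh_in x a| = r./2 by rewrite -Lx (link_left neckG).
have card_b : #|nbh_in x b| = r./2 by rewrite -Rx (link_right neckG).
have lt_an := side_lt a card_a; have lt_bn := side_lt b card_b.
have neq_ab : a != b by rewrite -Lx -Rx (link_sides neckG).
have old_n (v : G) : (copy v == Some n) = false.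
  by apply/eqP => /(copy_lt neckG); rewrite ltnn.
(* Only a vertex of the copy [a] or [b] can have [x] as outside neighbor. *)
pose out' (y : H) : H :=
  match y with
  | inl (inl v) =>
      if insub (out (val v)) is Some z then old z
      else piece (copy (val v) == Some b)
  | inl (inr d) => piece d
  | inr i => piece (r./2 <= i)
  end.
pose L' (y : H) : nat :=
  match y with inl (inl v) => L (val v) | inl (inr d) => if d then n else a | inr _ => 0 end.
pose R' (y : H) : nat :=
  match y with inl (inl v) => R (val v) | inl (inr d) => if d then b else n | inr _ => 0 end.
have copy_out' v : copy (out' (old v)) = copy (out (val v)).
  by rewrite /=; case: insubP => [z _ <- //|]; rewrite negbK => /eqP->; rewrite x0.
have piece_old d : #|nbh_in (piece d) (if d then b else a)| = r./2.
  rewrite -[RHS](_ : #|nbh_in x (if d then b else a)| = _); last by case: d.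
  apply: card_old => [|[[v|d']|i]]; rewrite !inE ?x0 ?andbF //=.
    by rewrite !inE -andbA andbb.
  by apply/negP => /andP[_ /eqP[]]; case: (d); lia.
have piece_new d : #|nbh_in (piece d) n| = r./2.
  rewrite (_ : nbh_in _ _ = [set new i | i in [set i : 'I_r | d == (r./2 <= i)]]).
    rewrite card_imset; last by move=> i j [].
    case: d; last first.
      rewrite -[RHS](@card_ord_lt r); last by lia.
      by apply: eq_card => i; rewrite !inE; lia.
    have halfK : r - r./2 = r./2 by lia.
    rewrite -[RHS]halfK -card_ord_ge; last by lia.
    by apply: eq_card => i; rewrite !inE.
  apply/setP => -[[v|d']|i]; rewrite !inE /= ?old_n ?andbF.
  - by apply/esym/imsetP => -[].
  - by apply/esym/imsetP => -[].
  rewrite eqxx andbT; apply/idP/imsetP => [|[j]]; first by exists i; rewrite ?inE.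
  by rewrite inE => ? [->].
exists out', L', R'; split.
- by move=> [[v|d]|i] c //= => [/(copy_lt neckG)/ltnW|[<-]].
- move=> c; rewrite ltnS leq_eqVlt => /predU1P[->|ltc].
    rewrite -[RHS](card_ord r) -(card_imset (f := new)); last by move=> i j [].
    apply: eq_card => -[[v|d]|i]; rewrite !inE /= ?old_n ?eqxx.
    + by apply/esym/imsetP => -[].
    + by apply/esym/imsetP => -[].
    + by rewrite imset_f.
  rewrite -(copy_card neckG ltc); apply: card_old => [|[[v|d]|i]].
  + by rewrite inE x0.
  + by rewrite !inE.
  + by rewrite inE.
  + by rewrite inE /=; apply/eqP=> -[]; lia.
- move=> [[v|d]|i] [[w|d']|j] c //=; first exact: (copy_clique neckG).
  + by move=> vc [eq_c]; move: (copy_lt neckG vc); rewrite -eq_c ltnn.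
  + by move=> [<-] /eqP; rewrite old_n.
- move=> [[v|d]|i] c //.
    by rewrite copy_out'; exact: (out_copy neckG).
- move=> [[v|d]|i] [[w|d']|j] c //.
  + move=> vc wc; rewrite [LHS](out_edge neckG vc wc) /=; case: insubP => [z _ val_z|].
      by rewrite -val_z.
    by rewrite negbK => /eqP->; exact/negbTE/(valP w).
  + move=> vc _; rewrite /= !inE.
    case xv: (edge x (val v)) => /=; last first.
      rewrite edge_sym (out_edge neckG vc) ?x0 // in xv.
      by case: insubP => //; rewrite negbK eq_sym xv.
    have eq_x : x = out (val v) by apply: (out_unique neckG vc); rewrite ?x0 // edge_sym.
    rewrite insubF; last by rewrite -eq_x /= eqxx.
    have [] := link_nbh neckG x0 xv; rewrite ?Lx ?Rx => vs; rewrite vs.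
      by case: d' => /=; rewrite ?eqxx (inj_eq Some_inj) (negbTE neq_ab).
    by case: d' => /=; rewrite ?eqxx // (inj_eq Some_inj) eq_sym (negbTE neq_ab).
  + by move=> vc _ /=; case: insubP.
  + by case=> <-; rewrite /= eqxx.
- move=> [[v|[]]|i] //=; [exact: (link_sides neckG) | lia | lia].
- move=> [[v|d]|i] // w0.
    rewrite -(link_left neckG w0); apply: card_old => [|[[w|d']|j]]; rewrite !inE ?x0 ?andbF //.
  by case: d w0 => _; [exact: piece_new | exact: (piece_old false)].
- move=> [[v|d]|i] // w0.
    rewrite -(link_right neckG w0); apply: card_old => [|[[w|d']|j]]; rewrite !inE ?x0 ?andbF //.
  by case: d w0 => _; [exact: (piece_old true) | exact: piece_new].
- move=> [[v|d]|i] // [[w|d']|j] w0 //=; first exact: (link_nbh neckG w0).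
  + by rewrite !inE (w0 : copy (val v) = None) andbF.
  + by rewrite !inE => /andP[_ /eqP->]; case: (d); [right | left].
  + by case: (d); [left | right].
- move=> c; rewrite ltnS leq_eqVlt => /predU1P[->|ltc] c_q.
    by exists (piece true).
  have [w w0 Lw] := left_cover neckG ltc c_q.
  have [eq_wx|neq_wx] := eqVneq w x; last by exists (old (Sub w neq_wx)).
  by exists (piece false) => //=; rewrite -Lw eq_wx.
- move=> c; rewrite ltnS leq_eqVlt => /predU1P[->|ltc] c_q.
    by exists (piece false).
  have [w w0 Rw] := right_cover neckG ltc c_q.
  have [eq_wx|neq_wx] := eqVneq w x; last by exists (old (Sub w neq_wx)).
  by exists (piece true) => //=; rewrite -Rw eq_wx.
- move=> [[v|d]|i] c d' //; rewrite copy_out'; exact: (cross_ends neckG).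
move=> c ends_c; rewrite (leq_trans (cross_card neckG ends_c)) //.
rewrite -(@card_old _ [set v : H | (copy v == Some c) && (copy (out' v) != None)]) //.
  by rewrite inE x0.
move=> [[v|d]|i]; rewrite inE ?copy_out' ?inE //=.
by rewrite andbF.
Qed.

End Split.

(** * The graphs E_k *)

Lemma is_E_necklace r k G : 4 <= r -> ~~ odd r -> is_E r k G ->
  [/\ #|G| = 2 * r + 1 + k * (r + 1), connected G
    & exists out L R p q, @necklace r k.+2 G out L R p q].
Proof.
move=> r_ge4 r_even; elim=> [|{}k {}G x a b _ [cardG connG]].
  split; [by rewrite E0_card; lia | exact: E0_connected |].
  by have [out neck0] := E0_necklace r_ge4 r_even; exists out, (fun=> 0), (fun=> 1), 0, 1.
move=> [out [L [R [p [q neckG]]]]] x0 neq_ab card_a card_b.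
have side c : #|nbh_in x c| = r./2 -> c = L x \/ c = R x.
  move=> card_x; have /card_gt0P[v] : 0 < #|nbh_in x c| by rewrite card_x; lia.
  rewrite !inE => /andP[xv /eqP vc].
  by case: (link_nbh neckG x0 xv); rewrite vc => -[->]; [left | right].
wlog [defa defb] : L R p q neckG side / L x = a /\ R x = b.
  move=> IH; case: (side a card_a) (side b card_b) => [aL|aR] [bL|bR].
  - by rewrite aL bL eqxx in neq_ab.
  - exact: (IH L R p q).
  - apply: (IH R L q p) => //; first exact: necklace_sym.
    by move=> c /side; rewrite or_comm.
  - by rewrite aR bR eqxx in neq_ab.
split.
- by rewrite split_card cardG; lia.
- apply: split_connected => // v xv; rewrite -defa -defb; exact: (link_nbh neckG).
have [out' [L' [R' neckH]]] := split_necklace r_ge4 r_even x0 defa defb neckG.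
by exists out', L', R', p, q.
Qed.

(** Informative, so as to define the sequence of graphs of the theorem; the
    vertex to split and its two copies are found by countable choice. *)
Lemma exists_E r : 4 <= r -> ~~ odd r -> forall k, {G : cgraph | is_E r k G}.
Proof.
move=> r_ge4 r_even; elim=> [|k [G EG]]; first by exists (E0 r); constructor.
have /sigW[[[x a] b] /and4P[/eqP x0 neq_ab /eqP card_a /eqP card_b]] :
    exists t : G * nat * nat, [&& copy t.1.1 == None, t.1.2 != t.2,
      #|nbh_in t.1.1 t.1.2| == r./2 & #|nbh_in t.1.1 t.2| == r./2].
  have [_ _ [out [L [R [p [q neckG]]]]]] := is_E_necklace r_ge4 r_even EG.
  have [w w0 _] : exists2 w : G, copy w = None & R w = (p == 0).
    by apply: (right_cover neckG); case: (p) => [|[]].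
  exists (w, L w, R w) => /=.
  by rewrite w0 (link_sides neckG w0) (link_left neckG w0) (link_right neckG w0) !eqxx.
by exists (Defs.split r x a b k.+2); constructor.
Qed.

Import Order.TTheory GRing.Theory Num.Theory.
Local Open Scope ring_scope.

Theorem mainTheorem2 (r : nat) (r_ge4 : (4 <= r)%N) (r_even : ~~ odd r) :
  (exists G : nat -> sgraph,
     (forall i j : nat, isomorphic (G i) (G j) -> i = j) /\
     (forall i : nat,
        [/\ connected (G i),
            regular r (G i),
            ~ isomorphic (G i) (Kmn r r)
          & (#|G i|%:R / (r + 1)%:R < (gamma_p (G i))%:R :> rat)])) /\
  (forall k : nat,
     (exists G : cgraph, is_E r k G) /\
     (forall G : cgraph, is_E r k G ->
        [/\ connected G,
            regular r G,
            #|G| = (2 * r + 1 + k * (r + 1))%N,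
            gamma_p G = (k + 2)%N
          & ((gamma_p G)%:R = (2 * r + 2 + k * (r + 1))%:R / (r + 1)%:R :> rat)])).
Proof.
have E_props k G : is_E r k G ->
    [/\ connected G, regular r G, #|G| = (2 * r + 1 + k * (r + 1))%N
      & gamma_p G = (k + 2)%N].
  move=> /(is_E_necklace r_ge4 r_even)[cardG connG [out [L [R [p [q neckG]]]]]].
  rewrite (necklace_gamma r_ge4 neckG) addn2.
  by split=> //; exact: (necklace_regular r_ge4 neckG).
have iso_card (G1 G2 : sgraph) : isomorphic G1 G2 -> #|G1| = #|G2|.
  by case=> f bij_f _; exact: bij_eq_card bij_f.
pose E k : cgraph := sval (exists_E r_ge4 r_even k).
have EP k : is_E r k (E k) by exact: svalP.
split; last first.
  move=> k; split=> [|G /E_props[connG regG cardG gammaG]]; first by exists (E k).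
  split=> //; rewrite gammaG.
  apply/(canRL (mulfK _)); first by rewrite pnatr_eq0 addn1.
  by rewrite -natrM; congr (_%:R); lia.
exists (fun k => E k : sgraph); split=> [i j /iso_card|i].
  have [_ _ -> _] := E_props _ _ (EP i); have [_ _ -> _] := E_props _ _ (EP j).
  by move/addnI/eqP; rewrite eqn_pmul2r ?addn1 // => /eqP.
have [connG regG cardG gammaG] := E_props _ _ (EP i).
split=> // [/iso_card|].
  by rewrite cardG card_sum card_ord; lia.
rewrite ltr_pdivrMr ?ltr0n ?addn1 // -natrM ltr_nat cardG gammaG; lia.
Qed.
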